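(* Let $\Gamma=(A_i,u_i)_{i=1,2}$ be a finite two-player game, let $z\in\Delta(A)$, $i\in\{1,2\}$ and $\varepsilon>0$. Assume that the maximal regret $R_{i,\max}(z)$ of player $i$ is less than $\varepsilon$. Then any action $k\in A_i$ with positive regret, i.e. $R_{i,k}(z)>0$, is an $\varepsilon$-best reply to the average play $z_{-i}$ of the opponent: $u_i(k,z_{-i})\ge\max_{s\in A_i}u_i(s,z_{-i})-\varepsilon$.
   Context: $A_i$ is the finite action set of player $i$, $A=A_1\times A_2$, $u_i:A\to\mathbb R$ is the payoff function, extended (multi)linearly to distributions; $-i$ denotes the opponent of $i$; $\Delta(S)$ is the set of probability distributions on a finite set $S$. For $z\in\Delta(A)$ (the average correlated play), $z_{-i}\in\Delta(A_{-i})$ denotes its marginal for the opponent of $i$, $R_{i,k}(z)=u_i(k,z_{-i})-u_i(z)$ is player $i$'s regret for action $k\in A_i$, and $R_{i,\max}(z)=\max_{k\in A_i}R_{i,k}(z)$. *)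

(* Defs.v *)
From mathcomp Require Import all_boot all_order all_algebra.
From mathcomp Require Import reals.

Set Implicit Arguments.
Unset Strict Implicit.
Unset Printing Implicit Defensive.

Import Order.TTheory GRing.Theory Num.Theory.
Local Open Scope ring_scope.

(* The seed [F x0] of the iterated maximum is itself one of the values, so this
   is the true maximum of [F] whenever [T] is nonempty; on an empty [T] it is
   the junk value 0. *)
Definition fmax (R : realType) (T : finType) (F : T -> R) : R :=
  if [pick x : T] is Some x0 then \big[Num.max/F x0]_(x : T) F x else 0.

Record dist (R : realType) (T : finType) := Dist {
  dist_fun :> {ffun T -> R};
  dist_ge0 : forall x, 0 <= dist_fun x;
  dist_sum1 : \sum_x dist_fun x = 1
}.

Section Pushforward.
Variables (R : realType) (S T : finType) (f : S -> T) (z : dist R S).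

Definition push_fun : {ffun T -> R} := [ffun t => \sum_(s | f s == t) z s].

Lemma push_ge0 t : 0 <= push_fun t.
Proof. by rewrite ffunE; apply: sumr_ge0 => s _; apply: dist_ge0. Qed.

Lemma push_sum1 : \sum_t push_fun t = 1.
Proof.
under eq_bigr do rewrite ffunE.
by rewrite -(dist_sum1 z) (partition_big f predT).
Qed.

Definition push : dist R T := Dist push_ge0 push_sum1.
End Pushforward.

Inductive player := P1 | P2.

Definition opponent (i : player) : player := if i is P1 then P2 else P1.

(* Nonemptiness of the action sets is not a field: it is forced by the
   existence of a distribution on [profile G]. *)
Record game (R : realType) := Game {
  action : player -> finType;
  payoff : player -> action P1 * action P2 -> R
}.

Section Regret.
Variables (R : realType) (G : game R).

Definition profile : finType := (action G P1 * action G P2)%type.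

Definition opponent_action (i : player) : profile -> action G (opponent i) :=
  match i return profile -> action G (opponent i) with
  | P1 => fun a => a.2
  | P2 => fun a => a.1
  end.

(* The profile in which [i] plays the first argument and the opponent of [i]
   the second, put back in the order (action of P1, action of P2). *)
Definition pair_profile (i : player) :
    action G i -> action G (opponent i) -> profile :=
  match i return action G i -> action G (opponent i) -> profile with
  | P1 => fun k s => (k, s)
  | P2 => fun k s => (s, k)
  end.

Definition marginal_opponent (i : player) (z : dist R profile) :
    dist R (action G (opponent i)) :=
  push (@opponent_action i) z.

(* u_i(z), the linear extension of u_i to correlated distributions *)
Definition payoff_corr (i : player) (z : dist R profile) : R :=
  \sum_(a : profile) z a * payoff i a.

(* u_i(k, y), the linear extension of u_i(k, -) to mixed actions y of the
   opponent *)
Definition payoff_vs (i : player) (k : action G i)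
    (y : dist R (action G (opponent i))) : R :=
  \sum_(s : action G (opponent i)) y s * payoff i (pair_profile k s).

Definition regret (i : player) (z : dist R profile) (k : action G i) : R :=
  payoff_vs k (marginal_opponent i z) - payoff_corr i z.

Definition regret_max (i : player) (z : dist R profile) : R :=
  fmax (fun k : action G i => regret z k).

End Regret.

(* Main.v *)
Require Import Defs.
From mathcomp Require Import all_boot all_order all_algebra.
From mathcomp Require Import reals.

Import Order.TTheory GRing.Theory Num.Theory.
Local Open Scope ring_scope.

(** The term [u_i(z)] in the regret does not depend on the action, so the payoffs
    of two actions against [z_{-i}] differ by exactly the difference of their
    regrets. Every action [s] has regret below [eps] and [k] has positive regret,
    hence [u_i(s, z_{-i}) - u_i(k, z_{-i}) < eps]; this bound passes to the maximum
    over [s], which is the least upper bound of its values ([le_fmax] and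
    [fmax_le]). *)

Lemma le_fmax (R : realType) (T : finType) (F : T -> R) (x : T) :
  F x <= fmax F.
Proof.
by rewrite /fmax; case: pickP => [x0 _ | /(_ x) //]; apply: le_bigmax.
Qed.

(** The witness [x0] rules out an empty [T], on which [fmax F] is 0 and the bound
    on the values of [F] holds vacuously. *)
Lemma fmax_le (R : realType) (T : finType) (F : T -> R) (x0 : T) (b : R) :
  (forall x, F x <= b) -> fmax F <= b.
Proof.
rewrite /fmax => Fb; case: pickP => [x1 _ | /(_ x0) //].
by apply: bigmax_le => [|x _]; apply: Fb.
Qed.

Theorem lemma1 (R : realType) (G : game R) (z : dist R (profile G))
    (i : player) (eps : R) (eps_gt0 : 0 < eps)
    (hmax : regret_max i z < eps)
    (k : action G i) (hk : 0 < regret z k) :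
  fmax (fun s : action G i => payoff_vs s (marginal_opponent i z)) - eps
    <= payoff_vs k (marginal_opponent i z).
Proof.
rewrite lerBlDr; apply: (fmax_le _ _ _ k) => s.
have regret_s : regret z s < eps by apply: le_lt_trans hmax; apply: le_fmax.
rewrite -(lerD2r (- payoff_corr i z)) addrAC -/(regret z s) -/(regret z k).
by apply: ltW; apply: lt_trans regret_s _; rewrite ltrDr.
Qed.
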